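(* For any $x\in\{0,1\}^{\mathbb{Z}}$, any integer $n>1$ and any $j\in\mathbb{Z}$, the state of the $j$-th cell after $n$ iterations of elementary cellular automaton rule 156 starting from $x$ is given by $$[F^n_{156}(x)]_j=\overline{x}_{j-1}x_{j}+\prod_{i=n-1}^{2n} x_{i-n+j}+ D(x,n,j)+ B_1(x,n,j)+ B_2(x,n,j)+ S_1(x,n,j)+ S_2(x,n,j),$$ where \begin{align*} D(x,n,j)&=x_{j-n}\prod_{m=j-n+1}^{j+1}\overline{x}_{m},\\ B_1(x,n,j)&=\mathcal{P}(n)\sum_{r=2}^{n}\Big(\mathcal{P}(r+1)\,x_{j-r}x_{j-r+1}x_{j+2}\prod_{m=j-r+2}^{j+1}\overline{x}_{m}\Big)\\ &\quad+\mathcal{P}(n+1)\sum_{r=2}^{n}\Big(\mathcal{P}(r)\,\overline{x}_{j-r}x_{j-r+1}x_{j+2}\prod_{m=j-r+2}^{j+1}\overline{x}_{m}\Big),\\ B_2(x,n,j)&=\mathcal{P}(n+1)\sum_{m=0}^{n-1}\Big(\mathcal{P}(m+1)\,\overline{x}_{j-2}\overline{x}_{j+m+1}\overline{x}_{j+m+2}\prod_{k=j-1}^{j+m}x_{k}\Big)\\ &\quad+\mathcal{P}(n)\sum_{m=0}^{n-1}\Big(\mathcal{P}(m)\,\overline{x}_{j-2}\overline{x}_{j+m+1}x_{j+m+2}\prod_{k=j-1}^{j+m}x_{k}\Big),\\ S_1(x,n,j)&=\sum_{k=1}^{n}\Big(\mathcal{P}(k)\,x_{j-k}x_{j-k+1}\prod_{m=j-k+2}^{j+1}\overline{x}_{m}\Big)+\sum_{k=2}^{n}\Big(\mathcal{P}(k+1)\,\overline{x}_{j-k}x_{j-k+1}\prod_{m=j-k+2}^{j+1}\overline{x}_{m}\Big),\\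 S_2(x,n,j)&=\sum_{k=2}^{n}\Big(\mathcal{P}(k)\,x_{j+k}\overline{x}_{j-1+k}\prod_{m=j-2}^{j+k-2}x_{m}\Big)+\sum_{k=2}^{n}\Big(\mathcal{P}(k+1)\,\overline{x}_{j+k}\overline{x}_{j-1+k}\prod_{m=j-2}^{j+k-2}x_{m}\Big). \end{align*}
   Context: For a Boolean value $t\in\{0,1\}$, write $\overline{t}=1-t$; all sums and products are taken in the integers. $\mathcal{P}(n)=1$ if $n$ is even and $\mathcal{P}(n)=0$ if $n$ is odd. The local function of rule 156 is $f_{156}:\{0,1\}^3\to\{0,1\}$, $$f_{156}(x_1,x_2,x_3)=\overline{x}_1x_2+x_1x_2x_3+x_1\overline{x}_2\overline{x}_3,$$ i.e. it equals $1$ exactly on $010,011,100,111$. The global function $F_{156}:\{0,1\}^{\mathbb{Z}}\to\{0,1\}^{\mathbb{Z}}$ is $[F_{156}(x)]_i=f_{156}(x_{i-1},x_i,x_{i+1})$, and $F_{156}^n$ is its $n$-fold composition. *)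

(* Defs.v *)
From mathcomp Require Import all_boot all_order all_algebra.
Set Implicit Arguments.
Unset Strict Implicit.
Unset Printing Implicit Defensive.
Import Order.TTheory GRing.Theory Num.Theory.
Local Open Scope ring_scope.

Definition config : Type := int -> bool.

(* All arithmetic is done in [int]; the explicit cast matters because [bool]
   carries its own (characteristic 2) ring structure in MathComp. *)
Definition bit (t : bool) : int := (nat_of_bool t)%:Z.

Definition cell (x : config) (i : int) : int := bit (x i).

Definition cocell (x : config) (i : int) : int := 1 - cell x i.

Definition f156 (x1 x2 x3 : bool) : bool :=
  [|| ~~ x1 && x2, [&& x1, x2 & x3] | [&& x1, ~~ x2 & ~~ x3]].

Lemma f156E (x1 x2 x3 : bool) :
  bit (f156 x1 x2 x3) =
    (1 - bit x1) * bit x2 + bit x1 * bit x2 * bit x3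
    + bit x1 * (1 - bit x2) * (1 - bit x3).
Proof. by case: x1; case: x2; case: x3. Qed.

Definition F156 (x : config) : config :=
  fun i => f156 (x (i - 1)) (x i) (x (i + 1)).

Definition parity (n : nat) : int := bit (~~ odd n).

(* Product over all integers i with a <= i <= b (both bounds included). *)
Definition prodz (a b : int) (F : int -> int) : int :=
  if a <= b then \prod_(0 <= k < `|b - a|%N.+1) F (a + k%:Z) else 1.

Reserved Notation "\prodz_ ( a <= i <= b ) F"
  (at level 36, F at level 36, i, a, b at level 50,
   format "'[' \prodz_ ( a  <=  i  <=  b ) '/  '  F ']'").
Notation "\prodz_ ( a <= i <= b ) F" := (prodz a b (fun i : int => F))
  : ring_scope.

Definition termD (x : config) (n : nat) (j : int) : int :=
  cell x (j - n%:Z) * \prodz_(j - n%:Z + 1 <= m <= j + 1) cocell x m.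

Definition termB1 (x : config) (n : nat) (j : int) : int :=
  parity n *
    (\sum_(2 <= r < n.+1)
      (parity r.+1 * cell x (j - r%:Z) * cell x (j - r%:Z + 1) * cell x (j + 2)
       * \prodz_(j - r%:Z + 2 <= m <= j + 1) cocell x m))
  + parity n.+1 *
    (\sum_(2 <= r < n.+1)
      (parity r * cocell x (j - r%:Z) * cell x (j - r%:Z + 1) * cell x (j + 2)
       * \prodz_(j - r%:Z + 2 <= m <= j + 1) cocell x m)).

Definition termB2 (x : config) (n : nat) (j : int) : int :=
  parity n.+1 *
    (\sum_(0 <= m < n)
      (parity m.+1 * cocell x (j - 2) * cocell x (j + m%:Z + 1)
       * cocell x (j + m%:Z + 2)
       * \prodz_(j - 1 <= k <= j + m%:Z) cell x k))
  + parity n *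
    (\sum_(0 <= m < n)
      (parity m * cocell x (j - 2) * cocell x (j + m%:Z + 1)
       * cell x (j + m%:Z + 2)
       * \prodz_(j - 1 <= k <= j + m%:Z) cell x k)).

Definition termS1 (x : config) (n : nat) (j : int) : int :=
  \sum_(1 <= k < n.+1)
    (parity k * cell x (j - k%:Z) * cell x (j - k%:Z + 1)
     * \prodz_(j - k%:Z + 2 <= m <= j + 1) cocell x m)
  + \sum_(2 <= k < n.+1)
    (parity k.+1 * cocell x (j - k%:Z) * cell x (j - k%:Z + 1)
     * \prodz_(j - k%:Z + 2 <= m <= j + 1) cocell x m).

Definition termS2 (x : config) (n : nat) (j : int) : int :=
  \sum_(2 <= k < n.+1)
    (parity k * cell x (j + k%:Z) * cocell x (j - 1 + k%:Z)
     * \prodz_(j - 2 <= m <= j + k%:Z - 2) cell x m)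
  + \sum_(2 <= k < n.+1)
    (parity k.+1 * cocell x (j + k%:Z) * cocell x (j - 1 + k%:Z)
     * \prodz_(j - 2 <= m <= j + k%:Z - 2) cell x m).

(* Main.v *)
Require Import Defs.
From mathcomp Require Import all_boot all_order all_algebra.
From mathcomp Require Import zify.
Import Order.TTheory GRing.Theory.
Local Open Scope ring_scope.

(** The word 01 is never altered by rule 156, so a cell j with x_(j-1) = 0, x_j = 1
    or with x_j = 0, x_(j+1) = 1 is frozen.  Otherwise x_(j-1) = x_j = 1 or
    x_j = x_(j+1) = 0, and reversal combined with complementation, which commutes
    with the rule, exchanges the two situations.  If x_(j-1) = x_j = 1, one step
    shortens the run of ones by one cell on its right and negates the symbol found
    just beyond the zero that ends it; x_(j-2) is unchanged.  Once the run ends at j,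
    a zero after that zero freezes j to 0; a one there makes j freeze to 1 when
    x_(j-2) = 1 and blink with period two when x_(j-2) = 0.  In each of these cases
    at most one summand of every sum in the formula survives. *)

(** * Frozen words and runs of ones *)

Lemma F156_01 (x : config) (i : int) :
  ~~ x (i - 1) -> x i -> ~~ F156 x (i - 1) && F156 x i.
Proof.
by rewrite /F156 /f156 subrK => /negbTE -> ->; rewrite !andbF.
Qed.

Lemma iter_01 (n : nat) (x : config) (i : int) :
  ~~ x (i - 1) -> x i -> ~~ iter n F156 x (i - 1) && iter n F156 x i.
Proof.
elim: n => [/= -> -> // | n IHn] x0 x1.
by rewrite !iterS; have /andP[] := IHn x0 x1; apply: F156_01.
Qed.

Lemma F156_11 (x : config) (i : int) : x (i - 1) -> x i -> x (i + 1) -> F156 x i.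
Proof. by rewrite /F156 /f156 => -> -> ->. Qed.

(** A run of ones loses at most one cell per step, at its right end; [j - 1] stays 1 because [f156]
    sends both 011 and 111 to 1. Peeling off the first step turns the margin [n.+1] into [n]. *)
Lemma iter_ones_inside (n : nat) (x : config) (j : int) :
  x (j - 1) -> (forall i : nat, (i <= n)%N -> x (j + i%:Z)) -> iter n F156 x j.
Proof.
elim: n x => [|n IHn] x xl xr; first by have := xr 0%N isT; rewrite addr0.
have x0 : x j by have := xr 0%N isT; rewrite addr0.
rewrite iterSr; apply: IHn => [|i le_in].
  by rewrite /F156 /f156 subrK xl x0; case: (x _).
apply: F156_11; last 2 first.
- by apply: xr; lia.
- by have := xr i.+1 le_in; congr is_true; congr x; lia.
case: i le_in => [|i] le_in; first by rewrite addr0.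
by have := xr i (leqW (ltnW le_in)); congr is_true; congr x; lia.
Qed.

(** Two frozen words 01 enclose [j], so its neighbours stay 1 and 0 forever, and [f156] negates the
    middle symbol between 1 and 0. *)
Lemma iter_blinker (n : nat) (x : config) (j : int) :
    ~~ x (j - 2) -> x (j - 1) -> ~~ x (j + 1) -> x (j + 2) ->
  iter n F156 x j = odd n (+) x j.
Proof.
have e1 : j - 2 = j - 1 - 1 by lia.
have e2 : j + 1 = j + 2 - 1 by lia.
move=> xa xb xd xe.
have inv k : ~~ iter k F156 x (j - 1 - 1) && iter k F156 x (j - 1).
  by apply: iter_01; rewrite -?e1.
have inv' k : ~~ iter k F156 x (j + 2 - 1) && iter k F156 x (j + 2).
  by apply: iter_01; rewrite -?e2.
elim: n => // n IHn; rewrite iterS {1}/F156 /f156 IHn e2.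
have /andP[_ ->] := inv n; have /andP[/negbTE -> _] := inv' n.
by rewrite /=; case: (odd n); case: (x j).
Qed.

(** The first step always sends [j] to 0. With a zero at [j + 2], the word 01 stands at [j], [j + 1]
    from then on; with ones at [j + 2] and [j - 2], it stands at [j - 1], [j] after two steps;
    otherwise [j] blinks. *)
Lemma iter_run_end (n : nat) (x : config) (j : int) :
    x (j - 1) -> x j -> ~~ x (j + 1) -> (0 < n)%N ->
  iter n F156 x j =
    [&& n != 1%N, x (j + 2) & x (j - 2) || ~~ odd n].
Proof.
move=> xb xc xd.
have Fc : F156 x j = false by rewrite /F156 /f156 xb xc (negbTE xd).
have e1 : j - 1 - 1 = j - 2 by lia.
have e2 : j + 1 + 1 = j + 2 by lia.
have [xe|xe] := boolP (x (j + 2)); last first.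
  case: n => // n _; rewrite iterSr andbF.
  have Fd : F156 x (j + 1).
    by rewrite /F156 /f156 addrK e2 xc (negbTE xd) (negbTE xe).
  have := @iter_01 n (F156 x) (j + 1); rewrite addrK Fc Fd.
  by case/(_ isT isT)/andP => /negbTE.
have [xa|xa] := boolP (x (j - 2)); last first.
  by rewrite iter_blinker // xc; case: n => [|[|n]]; rewrite //= addbT.
case: n => // -[|n] _; first by rewrite /= Fc.
rewrite 2!iterSr.
have Fb : F156 x (j - 1) by rewrite /F156 /f156 e1 subrK xa xb xc.
have Fd : F156 x (j + 1) = false.
  by rewrite /F156 /f156 addrK e2 xc (negbTE xd) xe.
have Fa : F156 x (j - 2).
  by rewrite /F156 /f156 -e1 subrK e1 xa xb; case: (x _).
have FFb : ~~ F156 (F156 x) (j - 1).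
  by rewrite {1}/F156 /f156 e1 subrK Fa Fb Fc.
have FFc : F156 (F156 x) j by rewrite {1}/F156 /f156 Fb Fc Fd.
by have /andP[_ ->] := iter_01 n _ _ FFb FFc.
Qed.

(** Each step lowers [m] and [n] together, so the comparison of their parities is invariant. The [m]
    negations of the symbol beyond the ending zero produce [~~ odd m]. *)
Lemma iter_run (m n : nat) (x : config) (j : int) :
    x (j - 1) -> (forall i : nat, (i <= m)%N -> x (j + i%:Z)) ->
    ~~ x (j + m%:Z + 1) -> (m < n)%N ->
  iter n F156 x j =
    [&& n != m.+1, x (j + m%:Z + 2) == ~~ odd m & x (j - 2) || (odd n == odd m)].
Proof.
elim: m n x => [|m IHm] n x xb xr xd lt_mn.
  rewrite addr0 in xd *; rewrite iter_run_end ?eqb_id ?eqbF_neg //.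
  by have := xr 0%N isT; rewrite addr0.
have x0 : x j by have := xr 0%N isT; rewrite addr0.
have x1 i : (i <= m)%N -> x (j + i%:Z + 1).
  by move=> le_im; have := xr i.+1 le_im; congr is_true; congr x; lia.
have e1 : j - 1 - 1 = j - 2 by lia.
have e2 : j + m.+1%:Z = j + m%:Z + 1 by lia.
have e3 : j + m%:Z + 1 + 1 = j + m%:Z + 2 by lia.
have e4 : j + m%:Z + 2 + 1 = j + m.+1%:Z + 2 by lia.
have xd' : x (j + m%:Z + 2) = false.
  by apply/negbTE; move: xd; congr (~~ _); congr x; lia.
have Fb : F156 x (j - 1) by rewrite /F156 /f156 e1 subrK xb x0; case: (x _).
have Fr i : (i <= m)%N -> F156 x (j + i%:Z).
  move=> le_im; apply: F156_11; [|by rewrite xr ?leqW|exact: x1].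
  case: i le_im => [|i] le_im; first by rewrite addr0.
  by have := xr i (leqW (ltnW le_im)); congr is_true; congr x; lia.
have xl : x (j + m%:Z) by apply: xr; lia.
have Fd : ~~ F156 x (j + m%:Z + 1).
  by rewrite /F156 /f156 addrK e3 xd' x1 ?xl.
have Fe : F156 x (j + m%:Z + 2) = ~~ x (j + m.+1%:Z + 2).
  rewrite /F156 /f156 e4 xd'; have -> : j + m%:Z + 2 - 1 = j + m%:Z + 1 by lia.
  by rewrite x1.
have Fa : F156 x (j - 2) = x (j - 2).
  rewrite /F156 /f156; have -> : j - 2 + 1 = j - 1 by lia.
  by rewrite xb; case: (x (j - 2)); case: (x _).
case: n lt_mn => // n lt_mn; rewrite iterSr IHm // Fe Fa eqSS /=.
by rewrite (inj_eq negb_inj); case: (x (j + _ + _)); case: (odd m); case: (odd n).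
Qed.

(** * Runs of zeros by reversal and complementation *)

Definition dual (x : config) : config := fun i => ~~ x (- i).

Lemma iter_dual (n : nat) (x : config) (j : int) :
  iter n F156 (dual x) j = ~~ iter n F156 x (- j).
Proof.
have F156E y i : F156 y i = f156 (y (i - 1)) (y i) (y (i + 1)) by [].
elim: n j => // n IHn j; rewrite !iterS !F156E !IHn.
have [-> ->] : - (j - 1) = - j + 1 /\ - (j + 1) = - j - 1 by lia.
rewrite /f156.
by case: (iter n F156 x (- j - 1)); case: (iter n F156 x (- j));
  case: (iter n F156 x (- j + 1)).
Qed.

Lemma iter_zeros_inside (n : nat) (x : config) (j : int) :
  ~~ x (j + 1) -> (forall i : nat, (i <= n)%N -> ~~ x (j - i%:Z)) ->
  ~~ iter n F156 x j.
Proof.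
move=> xr xl; rewrite -[j]opprK -iter_dual; apply: iter_ones_inside.
  by rewrite /dual opprB opprK addrC.
by move=> i le_in; rewrite /dual opprD opprK; apply: xl.
Qed.

(** This is [iter_run] for [dual x] at [- j]; the complement turns its conjunction into a
    disjunction. *)
Lemma iter_zero_run (m n : nat) (x : config) (j : int) :
    ~~ x (j + 1) -> (forall i : nat, (i <= m)%N -> ~~ x (j - i%:Z)) ->
    x (j - m%:Z - 1) -> (m < n)%N ->
  iter n F156 x j =
    [|| n == m.+1, x (j - m%:Z - 2) == ~~ odd m | x (j + 2) && (odd n != odd m)].
Proof.
move=> xr xl xe lt_mn.
have := @iter_run m n (dual x) (- j).
have -> : - j - 1 = - (j + 1) by lia.
have -> : - j - 2 = - (j + 2) by lia.
have -> : - j + m%:Z + 1 = - (j - m%:Z - 1) by lia.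
have -> : - j + m%:Z + 2 = - (j - m%:Z - 2) by lia.
rewrite iter_dual /dual !opprK xe => /(_ xr) H.
apply: negb_inj; rewrite H //.
  by case: (n == _); case: (x _); case: (x _); case: (odd m); case: (odd n).
by move=> i le_im; rewrite opprD opprK; apply: xl.
Qed.

(** * Products and sums with at most one surviving summand *)

Lemma prodz_eq0 (a b i : int) (F : int -> int) :
  a <= i -> i <= b -> F i = 0 -> prodz a b F = 0.
Proof.
move=> le_ai le_ib Fi0; rewrite /prodz (le_trans le_ai le_ib).
have lt_k : (`|i - a| < `|b - a|.+1)%N by lia.
rewrite big_mkord (bigD1 (Ordinal lt_k)) //=.
have -> : a + `|i - a|%N%:Z = i by lia.
by rewrite Fi0 mul0r.
Qed.

Lemma prodz_eq1 (a b : int) (F : int -> int) :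
  (forall i, a <= i -> i <= b -> F i = 1) -> prodz a b F = 1.
Proof.
rewrite /prodz => F1; case: ifP => // le_ab.
by rewrite big_nat_cond big1 // => k /andP[/andP[_ lt_k] _]; apply: F1; lia.
Qed.

Lemma sum_nat_eq0 (a b : nat) (F : nat -> int) :
  (forall k, (a <= k < b)%N -> F k = 0) -> \sum_(a <= k < b) F k = 0.
Proof.
by move=> F0; rewrite big_nat_cond big1 // => k /andP[k_in _]; apply: F0.
Qed.

(** The index [k0] may fall outside the range: the surviving index is often [m.+2], which exceeds
    the upper limit [n] when [n = m.+1]. *)
Lemma sum_nat_single (k0 a b : nat) (F : nat -> int) :
    (forall k, (a <= k < b)%N -> k != k0 -> F k = 0) ->
  \sum_(a <= k < b) F k = if (a <= k0 < b)%N then F k0 else 0.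
Proof.
move=> F0; case: ifP => k0_in.
  rewrite (bigD1_seq k0) ?mem_index_iota ?iota_uniq //= big_nat_cond.
  by rewrite big1 ?addr0 // => k /andP[]; apply: F0.
apply: sum_nat_eq0 => k k_in; apply: F0 => //.
by apply: contraFneq k0_in => <-.
Qed.

Lemma cell1 (x : config) (i : int) : x i -> cell x i = 1.
Proof. by rewrite /cell => ->. Qed.

Lemma cell0 (x : config) (i : int) : ~~ x i -> cell x i = 0.
Proof. by rewrite /cell => /negbTE ->. Qed.

Lemma cocell1 (x : config) (i : int) : ~~ x i -> cocell x i = 1.
Proof. by rewrite /cocell => /cell0 ->. Qed.

Lemma cocell0 (x : config) (i : int) : x i -> cocell x i = 0.
Proof. by rewrite /cocell => /cell1 ->. Qed.

(** Used on the run starting at [j]: either it reaches distance [n], or its first break is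
    located. *)
Lemma first_failure (p : pred nat) (n : nat) :
  (forall i, (i <= n)%N -> p i) \/
  exists2 m, (m <= n)%N & ~~ p m /\ forall i, (i < m)%N -> p i.
Proof.
elim: n => [|n [pn | [m le_mn pm]]]; last by right; exists m; rewrite ?leqW.
  have [p0 | p0] := boolP (p 0%N); last by right; exists 0%N.
  by left=> i; rewrite leqn0 => /eqP ->.
have [pn1 | pn1] := boolP (p n.+1); last by right; exists n.+1.
by left=> i; rewrite leq_eqVlt => /predU1P[-> // | /pn].
Qed.

(** * Values of the terms of the formula *)

Lemma one_terms_eq0 (x : config) (n : nat) (j : int) :
    ~~ (x (j - 1) && x j) ->
  [/\ \prodz_(n%:Z - 1 <= i <= 2 * n%:Z) cell x (i - n%:Z + j) = 0,
      termB2 x n j = 0 & termS2 x n j = 0].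
Proof.
rewrite negb_and => x01.
(* All the products concerned range over both [j - 1] and [j], so a single zero there kills them. *)
have [i [le_i i_le xi]] : exists i, [/\ j - 1 <= i, i <= j & cell x i = 0].
  by case/orP: x01 => /cell0; [exists (j - 1) | exists j]; split => //; lia.
split.
- apply: (@prodz_eq0 _ _ (i - j + n%:Z)); [lia | lia |].
  by rewrite -[RHS]xi; congr cell; lia.
- rewrite /termB2 !sum_nat_eq0 ?mulr0 // => k k_in;
    rewrite (@prodz_eq0 _ _ i) ?mulr0 //; lia.
- rewrite /termS2 !sum_nat_eq0 // => k k_in;
    rewrite (@prodz_eq0 _ _ i) ?mulr0 //; lia.
Qed.

Lemma zero_terms_eq0 (x : config) (n : nat) (j : int) :
    (0 < n)%N -> x j || x (j + 1) ->
  [/\ termD x n j = 0, termB1 x n j = 0 & termS1 x n j = 0].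
Proof.
move=> n_gt0 x01.
have [i [le_i i_le xi]] : exists i, [/\ j <= i, i <= j + 1 & cocell x i = 0].
  by case/orP: x01 => /cocell0; [exists j | exists (j + 1)]; split => //; lia.
split.
- rewrite /termD (@prodz_eq0 _ _ i) ?mulr0 //; lia.
- rewrite /termB1 !sum_nat_eq0 ?mulr0 // => k k_in;
    rewrite (@prodz_eq0 _ _ i) ?mulr0 //; lia.
(* For [k = 1] the product misses cell [j], but the factor [parity 1] is 0. *)
- rewrite /termS1 !sum_nat_eq0 // => -[|[|k]] k_in //; rewrite ?mul0r //;
    rewrite (@prodz_eq0 _ _ i) ?mulr0 //; lia.
Qed.

(** The long product covers exactly the cells [j - 1] to [j + n], while every summand of [termB2]
    and [termS2] asks for a zero inside the run. *)
Lemma one_terms_inside (x : config) (n : nat) (j : int) :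
    x (j - 1) -> (forall i : nat, (i <= n)%N -> x (j + i%:Z)) ->
  [/\ \prodz_(n%:Z - 1 <= i <= 2 * n%:Z) cell x (i - n%:Z + j) = 1,
      termB2 x n j = 0 & termS2 x n j = 0].
Proof.
move=> xb xr.
have xi (i : int) : j <= i -> i <= j + n%:Z -> x i.
  move=> ? ?; have -> : i = j + `|i - j|%N%:Z by lia.
  by apply: xr; lia.
split.
- apply: prodz_eq1 => i le_i i_le; apply: cell1.
  have [-> // | ne_i] := eqVneq (i - n%:Z + j) (j - 1); apply: xi; lia.
- by rewrite /termB2 !sum_nat_eq0 ?mulr0 // => k k_in;
    rewrite (@cocell0 x (j + k%:Z + 1)) ?(mulr0, mul0r) // xi; lia.
- by rewrite /termS2 !sum_nat_eq0 // => k k_in;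
    rewrite (@cocell0 x (j - 1 + k%:Z)) ?(mulr0, mul0r) // xi; lia.
Qed.

Lemma zero_terms_inside (x : config) (n : nat) (j : int) :
    (forall i : nat, (i <= n)%N -> ~~ x (j - i%:Z)) ->
  [/\ termD x n j = 0, termB1 x n j = 0 & termS1 x n j = 0].
Proof.
move=> xl.
have xi (i : int) : j - n%:Z <= i -> i <= j -> ~~ x i.
  move=> ? ?; have -> : i = j - `|i - j|%N%:Z by lia.
  by apply: xl; lia.
split.
- by rewrite /termD cell0 ?mul0r // xl.
- by rewrite /termB1 !sum_nat_eq0 ?mulr0 // => k k_in;
    rewrite (@cell0 x (j - k%:Z + 1)) ?(mulr0, mul0r) // xi; lia.
- by rewrite /termS1 !sum_nat_eq0 // => k k_in;
    rewrite (@cell0 x (j - k%:Z + 1)) ?(mulr0, mul0r) // xi; lia.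
Qed.

(** The zero at [j + m + 1] selects one summand: smaller indices ask for a zero inside the run,
    larger ones have this zero in their product. The index is [m] in [termB2] and [m.+2] in
    [termS2]. *)
Lemma one_terms_run (m n : nat) (x : config) (j : int) :
    x (j - 1) -> (forall i : nat, (i <= m)%N -> x (j + i%:Z)) ->
    ~~ x (j + m%:Z + 1) -> (m < n)%N ->
  [/\ \prodz_(n%:Z - 1 <= i <= 2 * n%:Z) cell x (i - n%:Z + j) = 0,
      termB2 x n j =
        bit [&& ~~ x (j - 2), odd n == odd m & x (j + m%:Z + 2) == ~~ odd m]
    & termS2 x n j =
        bit [&& (m.+1 < n)%N, x (j - 2) & x (j + m%:Z + 2) == ~~ odd m]].
Proof.
move=> xb xr xd lt_mn.
have xi (i : int) : j - 1 <= i -> i <= j + m%:Z -> x i.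
  have [-> // | ne_i] := eqVneq i (j - 1); move=> ? ?.
  have -> : i = j + `|i - j|%N%:Z by lia.
  by apply: xr; lia.
split.
(* After the shift by [j - n] this index points at the zero [j + m + 1]; it is at most [2 * n] since
   [m < n]. *)
- apply: (@prodz_eq0 _ _ (m.+1%:Z + n%:Z)); [lia | lia |].
  by apply: cell0; move: xd; congr (~~ _); congr x; lia.
- have F0 (k : nat) (a b : int) : k != m ->
      a * cocell x (j + k%:Z + 1) * b * \prodz_(j - 1 <= i <= j + k%:Z) cell x i
      = 0.
    move=> ne_km; have [lt_km | le_mk] := ltnP k m.
      by rewrite cocell0 ?(mul0r, mulr0) // xi; lia.
    by rewrite (@prodz_eq0 _ _ (j + m%:Z + 1)) ?mulr0 ?cell0 //; lia.
  rewrite /termB2 !(@sum_nat_single m); try by move=> k _ /F0 ->.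
  rewrite leq0n lt_mn prodz_eq1 => [|i ? ?]; last by rewrite cell1 ?xi.
  rewrite (@cocell1 x _ xd) /cocell /cell /parity /=.
  by case: (x (j - 2)); case: (x _); case: (odd m); case: (odd n).
- have F0 (k : nat) (a : int) : (1 < k)%N -> k != m.+2 ->
      a * cocell x (j - 1 + k%:Z) * \prodz_(j - 2 <= i <= j + k%:Z - 2) cell x i
      = 0.
    move=> k_gt1 ne_km; have [lt_km | le_mk] := ltnP k m.+2.
      by rewrite cocell0 ?(mul0r, mulr0) // xi; lia.
    by rewrite (@prodz_eq0 _ _ (j + m%:Z + 1)) ?mulr0 ?cell0 //; lia.
  rewrite /termS2 !(@sum_nat_single m.+2);
    try by move=> k /andP[k_gt1 _] /(F0 _ _ k_gt1) ->.
  have [-> ->] : j - 1 + m.+2%:Z = j + m%:Z + 1 /\ j + m.+2%:Z = j + m%:Z + 2.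
    by lia.
  (* All cells of the range other than [j - 2] lie in the run. *)
  have -> : prodz (j - 2) (j + m%:Z + 2 - 2) (fun i => cell x i) = cell x (j - 2).
    have [xa | xa] := boolP (x (j - 2)); last first.
      by rewrite (@prodz_eq0 _ _ (j - 2)) ?cell0 //; lia.
    rewrite (cell1 _ _ xa) prodz_eq1 // => i ? ?; apply: cell1.
    by have [-> // | ne_i] := eqVneq i (j - 2); apply: xi; lia.
  rewrite (@cocell1 x _ xd) /cocell /cell /parity /= ltnS.
  case: (ltnP m.+1 n) => _ //.
  by case: (x (j - 2)); case: (x _); case: (odd m); case: (odd n).
Qed.

(** The one at [j - m - 1] selects index [m.+2] in both sums; [termD] asks for it at distance
    exactly [n]. *)
Lemma zero_terms_run (m n : nat) (x : config) (j : int) :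
    ~~ x (j + 1) -> (forall i : nat, (i <= m)%N -> ~~ x (j - i%:Z)) ->
    x (j - m%:Z - 1) -> (m < n)%N ->
  [/\ termD x n j = bit (n == m.+1),
      termB1 x n j =
        bit [&& (m.+1 < n)%N, x (j + 2), odd n != odd m
              & x (j - m%:Z - 2) != ~~ odd m]
    & termS1 x n j = bit ((m.+1 < n)%N && (x (j - m%:Z - 2) == ~~ odd m))].
Proof.
move=> xr xl xe lt_mn.
have xi (i : int) : j - m%:Z <= i -> i <= j + 1 -> ~~ x i.
  have [-> // | ne_i] := eqVneq i (j + 1); move=> ? ?.
  have -> : i = j - `|i - j|%N%:Z by lia.
  by apply: xl; lia.
have F0 (k : nat) (a b : int) : (1 < k)%N -> k != m.+2 ->
    a * cell x (j - k%:Z + 1) * b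
      * \prodz_(j - k%:Z + 2 <= i <= j + 1) cocell x i = 0.
  move=> k_gt1 ne_km; have [lt_km | le_mk] := ltnP k m.+2.
    by rewrite cell0 ?(mul0r, mulr0) // xi; lia.
  by rewrite (@prodz_eq0 _ _ (j - m%:Z - 1)) ?mulr0 ?cocell0 //; lia.
have P1 : \prodz_(j - m.+2%:Z + 2 <= i <= j + 1) cocell x i = 1.
  by apply: prodz_eq1 => i ? ?; apply: cocell1; apply: xi; lia.
have [e1 e2] : j - m.+2%:Z + 1 = j - m%:Z - 1 /\ j - m.+2%:Z = j - m%:Z - 2.
  by lia.
split.
- rewrite /termD; have [-> | ne_nm] := eqVneq n m.+1.
    rewrite prodz_eq1 ?mulr1 => [|i ? ?]; last by apply/cocell1/xi; lia.
    by rewrite cell1 //; move: xe; congr is_true; congr x; lia.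
  by rewrite (@prodz_eq0 _ _ (j - m%:Z - 1)) ?mulr0 ?cocell0 //; lia.
- rewrite /termB1 !(@sum_nat_single m.+2);
    try by move=> k /andP[k_gt1 _] /(F0 _ _ _ k_gt1) ->.
  rewrite P1 e1 e2 (@cell1 x _ xe) /cocell /cell /parity /= ltnS.
  case: (ltnP m.+1 n) => _ //; last by rewrite !mulr0.
  by case: (x (j + 2)); case: (x _); case: (odd m); case: (odd n).
- rewrite /termS1 !(@sum_nat_single m.+2); last 2 first.
  (* These summands lack the factor at [j + 2]; a 1 takes its place to match [F0]. *)
  + by move=> k /andP[k_gt1 _] ne_k; rewrite -[_ * cell _ _]mulr1 F0.
  + move=> [|[|k]] // _ ne_k; first by rewrite !mul0r.
    by rewrite -[_ * cell _ (_ + 1)]mulr1 F0.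
  rewrite P1 e1 e2 (@cell1 x _ xe) /cocell /cell /parity /= ltnS.
  case: (ltnP m.+1 n) => _ //.
  by case: (x _); case: (odd m); case: (odd n).
Qed.

(** * Case analysis around the cell *)

Theorem theorem2 (x : config) (n : nat) (j : int) (hn : (1 < n)%N) :
  cell (iter n F156 x) j =
    cocell x (j - 1) * cell x j
    + \prodz_(n%:Z - 1 <= i <= 2 * n%:Z) cell x (i - n%:Z + j)
    + termD x n j + termB1 x n j + termB2 x n j + termS1 x n j + termS2 x n j.
Proof.
have n_gt0 : (0 < n)%N := ltnW hn.
have [xc | xc] := boolP (x j).
  have [-> -> ->] : [/\ termD x n j = 0, termB1 x n j = 0 & termS1 x n j = 0].
    by apply: zero_terms_eq0; rewrite ?xc.
  have [xb | xb] := boolP (x (j - 1)); last first.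
    have [|-> -> ->] := one_terms_eq0 x n j; first by rewrite (negbTE xb).
    have /andP[_ x1] := iter_01 n _ _ xb xc.
    by rewrite !cell1 // cocell1.
  rewrite (cocell0 _ _ xb) mul0r add0r !addr0.
  (* The first zero is at distance [m.+1], so the last one of the run is at distance [m]; distance 0
     is excluded by [xc]. *)
  have [xr | [[|m] le_mn [xd xr]]] := first_failure (fun i => x (j + i%:Z)) n.
  - have [-> -> ->] := one_terms_inside x n j xb xr.
    by rewrite cell1 ?iter_ones_inside.
  - by rewrite /= addr0 xc in xd.
  have xd' : ~~ x (j + m%:Z + 1) by move: xd; congr (~~ _); congr x; lia.
  have [-> -> ->] := one_terms_run m n x j xb xr xd' le_mn.
  rewrite /cell (iter_run m) // eqn_leq le_mn andbT -ltnNge.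
  (* The opposite conditions on [x (j - 2)] make [termB2] and [termS2] exclusive, so their sum is
     the disjunction in [iter_run]. *)
  case: (ltnP m.+1 n) => [_ | le_nm].
    by case: (x (j - 2)); case: (x _); case: (odd m); case: (odd n).
  (* The run has just ended and the cell is 0; [termB2] vanishes because [n] and [m] differ in
     parity. *)
  have -> : n = m.+1 by lia.
  by rewrite /=; case: (odd m); rewrite /= !andbF.
have [|-> -> ->] := one_terms_eq0 x n j; first by rewrite (negbTE xc) andbF.
rewrite (cell0 _ _ xc) mulr0 !add0r !addr0.
have [xd | xd] := boolP (x (j + 1)).
  have [||-> -> ->] := zero_terms_eq0 x n j => //; first by rewrite xd orbT.
  have := iter_01 n x (j + 1); rewrite addrK => /(_ xc xd) /andP[x0 _].
  by rewrite cell0.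
have [xl | [[|m] le_mn [xe xl]]] := first_failure (fun i => ~~ x (j - i%:Z)) n.
- have [-> -> ->] := zero_terms_inside x n j xl.
  by rewrite cell0 ?iter_zeros_inside.
- by rewrite /= subr0 xc in xe.
have xe' : x (j - m%:Z - 1).
  by move/negPn: xe; congr is_true; congr x; lia.
have [-> -> ->] := zero_terms_run m n x j xd xl xe' le_mn.
rewrite /cell (iter_zero_run m) //; have [-> | ne_nm] := eqVneq n m.+1.
  by rewrite ltnn.
(* Here [termB1] and [termS1] are exclusive through their opposite conditions on [x (j - m - 2)]. *)
have -> : (m.+1 < n)%N by lia.
by case: (x (j + 2)); case: (x _); case: (odd m); case: (odd n).
Qed.
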